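(* Let $n\ge 2$, let $K$ be a field, and let $A$ be a total associative $n$-algebra over $K$. Then the Jordan $n$-commutator algebra $\{A\}$ satisfies the identity $f^{\{2\}}_{-1}=0$; that is, $F^{\{2\}}_1(a_1,\ldots,a_{3n-2})-F^{\{2\}}_2(a_1,\ldots,a_{3n-2})=0$ for all $a_1,\ldots,a_{3n-2}\in A$, where $F^{\{2\}}_1,F^{\{2\}}_2$ are evaluated with $\omega$ equal to the Jordan $n$-commutator of $A$.
   Context: An $n$-algebra over $K$ is a $K$-vector space $A$ with a multilinear map $A\times\cdots\times A\to A$ of $n$ arguments, $(a_1,\ldots,a_n)\mapsto(a_1,\ldots,a_n)$. It is total associative if $$(a_1,\ldots,a_i,(a_{i+1},\ldots,a_{i+n}),a_{i+n+1},\ldots,a_{2n-1})=(a_1,\ldots,a_{i+1},(a_{i+2},\ldots,a_{i+n+1}),a_{i+n+2},\ldots,a_{2n-1})$$ for all $0\le i\le n-2$ and all $a_1,\ldots,a_{2n-1}\in A$. $Sym_m$ is the group of permutations of $\{1,\ldots,m\}$. The algebra $\{A\}$ is the vector space $A$ with the $n$-multiplication (Jordan $n$-commutator) $$\{a_1,\ldots,a_n\}=\sum_{\sigma\in Sym_n}(a_{\sigma(1)},\ldots,a_{\sigma(n)}).$$ Sets of shuffle permutations: $$S_{n-1,n-1,n}=\{\sigma\in Sym_{3n-2}: \sigma(1)<\cdots<\sigma(n-1),\ \sigma(n)<\cdots<\sigma(2n-2),\ \sigma(2n-1)<\cdots<\sigma(3n-2)\},$$ $$S_{n-2,n,n}=\{\sigma\in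 Sym_{3n-2}: \sigma(1)<\cdots<\sigma(n-2),\ \sigma(n-1)<\cdots<\sigma(2n-2),\ \sigma(2n-1)<\cdots<\sigma(3n-2),\ \sigma(n-1)<\sigma(2n-1)\}.$$ For an $n$-ary operation $\omega$, $$F^{\{2\}}_1(t_1,\ldots,t_{3n-2})=\sum_{\substack{\sigma\in S_{n-1,n-1,n}\\ \sigma(n)=1}}\omega\bigl(t_{\sigma(1)},\ldots,t_{\sigma(n-1)},\omega(t_1,t_{\sigma(n+1)},\ldots,t_{\sigma(2n-2)},\omega(t_{\sigma(2n-1)},\ldots,t_{\sigma(3n-2)}))\bigr),$$ $$F^{\{2\}}_2(t_1,\ldots,t_{3n-2})=\sum_{\substack{\sigma\in S_{n-2,n,n}\\ \sigma(n-1)=1}}\omega\bigl(t_{\sigma(1)},\ldots,t_{\sigma(n-2)},\omega(t_1,t_{\sigma(n)},\ldots,t_{\sigma(2n-2)}),\omega(t_{\sigma(2n-1)},\ldots,t_{\sigma(3n-2)})\bigr),$$ and $f^{\{2\}}_\lambda=F^{\{2\}}_1+\lambda F^{\{2\}}_2$. *)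

(* Defs.v *)
From mathcomp Require Import all_boot all_order all_fingroup all_algebra.

Set Implicit Arguments.
Unset Strict Implicit.
Unset Printing Implicit Defensive.

Import GRing.Theory.
Local Open Scope ring_scope.

(* The subsequence s_i, ..., s_j of s = s_1, s_2, ..., with indices starting
   at 1; it is empty when j = i - 1. *)
Definition block (T : Type) (i j : nat) (s : seq T) : seq T :=
  take (j.+1 - i) (drop i.-1 s).

(* An n-ary operation applied to a list of arguments. It is only ever used on
   lists of length n; otherwise the list is truncated or padded with 0. *)
Definition app (n : nat) (A : zmodType) (w : n.-tuple A -> A) (s : seq A) : A :=
  w [tuple s`_k | k < n].

Definition multilinear (n : nat) (K : fieldType) (A : lmodType K)
    (w : n.-tuple A -> A) : Prop :=
  forall (t : n.-tuple A) (i : 'I_n),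
    linear (fun x : A => w [tuple if k == i then x else tnth t k | k < n]).

Definition total_associative (n : nat) (A : zmodType)
    (w : n.-tuple A -> A) : Prop :=
  forall (i : nat) (a : (2 * n - 1).-tuple A), (i <= n - 2)%N ->
    app w (block 1 i a ++ app w (block (i + 1) (i + n) a)
             :: block (i + n + 1) (2 * n - 1) a)
  = app w (block 1 (i + 1) a ++ app w (block (i + 2) (i + n + 1) a)
             :: block (i + n + 2) (2 * n - 1) a).

Definition jordan (n : nat) (A : zmodType) (w : n.-tuple A -> A)
    (a : n.-tuple A) : A :=
  \sum_(s : 'S_n) w [tuple tnth a (s i) | i < n].

(* One-line notation s(1), ..., s(m), where {1, ..., m} is 'I_m shifted by 1. *)
Definition one_line (m : nat) (s : 'S_m) : seq nat :=
  [seq (s i).+1 | i : 'I_m].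

(* The value s(k), with arguments and values in {1, ..., m}. *)
Definition perm_at (m : nat) (s : 'S_m) (k : nat) : nat :=
  nth 0%N (one_line s) k.-1.

(* S_{n-1,n-1,n} *)
Definition shuffles1 (n : nat) : {set 'S_(3 * n - 2)} :=
  [set s : 'S_(3 * n - 2) |
    [&& sorted ltn (block 1 (n - 1) (one_line s)),
        sorted ltn (block n (2 * n - 2) (one_line s))
      & sorted ltn (block (2 * n - 1) (3 * n - 2) (one_line s))]].

(* S_{n-2,n,n} *)
Definition shuffles2 (n : nat) : {set 'S_(3 * n - 2)} :=
  [set s : 'S_(3 * n - 2) |
    [&& sorted ltn (block 1 (n - 2) (one_line s)),
        sorted ltn (block (n - 1) (2 * n - 2) (one_line s)),
        sorted ltn (block (2 * n - 1) (3 * n - 2) (one_line s))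
      & (perm_at s (n - 1) < perm_at s (2 * n - 1))%N]].

(* t_{s(1)}, ..., t_{s(m)} *)
Definition permuted (m : nat) (A : Type) (t : m.-tuple A) (s : 'S_m) : seq A :=
  [seq tnth t (s i) | i : 'I_m].

(* In F1 and F2, t`_0 is t_1. *)
Definition F1 (n : nat) (A : zmodType) (w : n.-tuple A -> A)
    (t : (3 * n - 2).-tuple A) : A :=
  \sum_(s in shuffles1 n | perm_at s n == 1%N)
    let u := permuted t s in
    app w (block 1 (n - 1) u ++
      [:: app w (t`_0 :: block (n + 1) (2 * n - 2) u ++
            [:: app w (block (2 * n - 1) (3 * n - 2) u)])]).

Definition F2 (n : nat) (A : zmodType) (w : n.-tuple A -> A)
    (t : (3 * n - 2).-tuple A) : A :=
  \sum_(s in shuffles2 n | perm_at s (n - 1) == 1%N)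
    let u := permuted t s in
    app w (block 1 (n - 2) u ++
      [:: app w (t`_0 :: block n (2 * n - 2) u);
          app w (block (2 * n - 1) (3 * n - 2) u)]).

Definition f2 (n : nat) (K : fieldType) (A : lmodType K) (lambda : K)
    (w : n.-tuple A -> A) (t : (3 * n - 2).-tuple A) : A :=
  F1 w t + lambda *: F2 w t.

(* Main.v *)
Require Import Defs.
From mathcomp Require Import all_boot all_order all_fingroup all_algebra.
From mathcomp Require Import zify.

(* Both F1 and F2 expand into sums of products of words, a word being a
   permutation of the arguments: a shuffle followed by permutations of its three
   blocks is an arbitrary permutation, and inserting the inner values at all
   places k, l accounts for the remaining freedom of the outer commutators.  By
   total associativity the product of a word does not depend on k, l.  So one
   only has to count, for each position x of the argument t_1 in a word, the
   pairs (k, l) for which t_1 lies where the definition of F1 (resp. F2)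
   requires; the reflections k -> x - k and k -> x - n - k, with l fixed,
   exchange the two sets of pairs. *)

Set Implicit Arguments.
Unset Strict Implicit.
Unset Printing Implicit Defensive.

Import GRing.Theory.

(** * Inserting one word into another *)

Section Splice.

Variable T : Type.
Implicit Types (x y : T) (s b c : seq T) (k l : nat).

Definition splice k b s := take k s ++ b ++ drop k s.

Lemma size_splice k b s : size (splice k b s) = size b + size s.
Proof. by rewrite !size_cat addnCA -size_cat cat_take_drop. Qed.

Lemma splice_splice k l b c s : k <= size s -> l <= size b ->
  splice k (splice l c b) s = splice (k + l) c (splice k b s).
Proof.
move=> ks lb; rewrite /splice !take_cat !drop_cat size_take.
have -> : (if k < size s then k else size s) = k by case: ltnP; lia.
rewrite ltnNge leq_addr /= addKn.
case: ltngtP lb => [lb|//|->] _; rewrite -!catA //.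
by rewrite subnn take0 drop0 take_size drop_size.
Qed.

(** The block further to the right moves by the length of the other one. At [j = k] the block [c]
    stands before [b] on both sides; [splice_comm_ge] covers the opposite order. *)
Lemma splice_comm_le j k b c s : j <= k -> k <= size s ->
  splice j c (splice k b s) = splice (k + size c) b (splice j c s).
Proof.
move=> jk ks; rewrite /splice !take_cat !drop_cat !size_take.
have -> : (if k < size s then k else size s) = k by case: ltnP; lia.
have -> : (if j < size s then j else size s) = j by case: ltnP; lia.
have -> : (k + size c < j) = false by lia.
have -> : (k + size c - j < size c) = false by lia.
have -> : k + size c - j - size c = k - j by lia.
case: ltngtP jk => // [jk|->] _; last first.
  by rewrite subnn sub0n; case: b => [|y b]; rewrite /= ?take0 ?drop0 ?cats0 -!catA.
by rewrite take_takel ?(ltnW jk) // take_drop drop_drop subnK ?(ltnW jk) // -!catA.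
Qed.

Lemma splice_comm_ge j k b c s : k <= j -> j <= size s ->
  splice (j + size b) c (splice k b s) = splice k b (splice j c s).
Proof. by move=> kj js; rewrite (splice_comm_le _ _ kj js). Qed.

Definition insert k x s := splice k [:: x] s.

End Splice.

Lemma map_splice (T U : Type) (f : T -> U) k b s :
  map f (splice k b s) = splice k (map f b) (map f s).
Proof. by rewrite !map_cat map_take map_drop. Qed.

Section SpliceEq.

Variable T : eqType.
Implicit Types (x y : T) (s b c : seq T) (k l : nat).

Lemma perm_splice k b s : perm_eq (splice k b s) (b ++ s).
Proof. by rewrite perm_catCA perm_cat2l cat_take_drop. Qed.

Lemma splice_inj k b s b' s' : size b = size b' -> size s = size s' ->
  splice k b s = splice k b' s' -> b = b' /\ s = s'.
Proof.
move=> eqb eqs /eqP; rewrite eqseq_cat ?size_take ?eqs // eqseq_cat //.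
case/and3P=> /eqP e1 /eqP -> /eqP e2; split=> //.
by rewrite -(cat_take_drop k s) e1 e2 cat_take_drop.
Qed.

Lemma index_splice k b s x : uniq s -> ~~ ((x \in b) && (x \in s)) ->
    (x \in b) || (x \in s) -> k <= size s ->
  index x (splice k b s) =
    if x \in b then k + index x b
    else if index x s < k then index x s else index x s + size b.
Proof.
move=> us nbs bs ks; rewrite !index_cat size_take.
have -> : (if k < size s then k else size s) = k by case: ltnP; lia.
case: ifP => [xt|xt].
  have xs := mem_take xt; move: nbs; rewrite xs andbT => /negbTE->.
  move: xt; rewrite (in_take _ xs) => lt.
  by rewrite lt -{2}(cat_take_drop k s) index_cat (in_take _ xs) lt.
case: ifP bs nbs => //= xb xs _; move: (xt); rewrite (in_take _ xs) => ->.
by rewrite -{2}(cat_take_drop k s) index_cat xt size_take; case: ltnP; lia.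
Qed.

(** Deleting [x] and recording its index inverts the insertion, because [x] occurs exactly once in a
    permutation of [x :: s]. *)
Lemma sum_permutations_cons (V : nmodType) x s (F : seq T -> V) :
  uniq (x :: s) ->
  (\sum_(v <- permutations (x :: s)) F v
   = \sum_(v <- permutations s) \sum_(k < (size s).+1) F (insert k x v))%R.
Proof.
move=> /= /andP[xs us].
under [RHS]eq_bigr => v _ do rewrite -(big_mkord predT (fun k => F (insert k x v))).
rewrite -(big_allpairs_dep (h := fun v k => insert k x v)).
apply/perm_big/uniq_perm.
- exact: permutations_uniq.
- apply: allpairs_uniq; rewrite ?permutations_uniq ?iota_uniq //.
  move=> p p' /allpairsP[[v k] [pv lk ->]] /allpairsP[[v' k'] [pv' lk' ->]].
  move: pv lk pv' lk' => /=.
  rewrite !mem_permutations !mem_index_iota /= => pv lk pv' lk' e.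
  have xv : x \notin v by rewrite (perm_mem pv).
  have xv' : x \notin v' by rewrite (perm_mem pv').
  have idx w i : x \notin w -> perm_eq w s -> i < (size s).+1 ->
      index x (insert i x w) = i.
    move=> xw pw li; rewrite index_cat; case: ifP => [/mem_take|_].
      by rewrite (negbTE xw).
    rewrite /= eqxx addn0 size_take (perm_size pw); case: ltnP; lia.
  have ek : k = k' by rewrite -(idx _ _ xv pv lk) e idx.
  move: e; rewrite -ek => /splice_inj; rewrite (perm_size pv) (perm_size pv').
  by case=> // _ ->.
- move=> v; rewrite mem_permutations; apply/idP/allpairsP => [pv|].
    have xv : x \in v by rewrite (perm_mem pv) mem_head.
    have sv := perm_size pv.
    exists (rem x v, index x v); rewrite /= mem_permutations mem_index_iota.
    have uv : uniq v by rewrite (perm_uniq pv) /= xs.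
    split.
    + rewrite -(perm_cons x) perm_sym; apply: perm_trans (perm_to_rem xv).
      by rewrite perm_sym.
    + by rewrite -[(size s).+1]sv index_mem.
    + rewrite remE /insert /splice take_size_cat ?size_takel ?index_size //.
      rewrite drop_size_cat ?size_takel ?index_size //.
      rewrite -{1}(cat_take_drop (index x v) v); congr (_ ++ _).
      by rewrite (drop_nth x) ?index_mem // nth_index.
case=> -[v' k] /= []; rewrite mem_permutations => pv' _ ->.
by rewrite (perm_trans (perm_splice _ _ _)) //= perm_cons.
Qed.

End SpliceEq.

Lemma size_in_permutations (v b : seq nat) : v \in permutations b -> size v = size b.
Proof. by rewrite mem_permutations; apply: perm_size. Qed.

(** * Sums over permutations, concatenations and shuffles *)

Section PermSums.

Variable V : nmodType.

(** Since the letters of [l] are distinct, different permutations give different words; there are m!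
    of each, so injectivity suffices. *)
Lemma sum_Sym_permutations (T : eqType) (m : nat) (x0 : T) (l : seq T)
    (P : pred (seq T)) (F : seq T -> V) :
  uniq l -> size l = m ->
  (\sum_(s : 'S_m | P [seq nth x0 l (s i) | i : 'I_m])
      F [seq nth x0 l (s i) | i : 'I_m]
   = \sum_(v <- permutations l | P v) F v)%R.
Proof.
move=> ul sl; pose h (s : 'S_m) := [seq nth x0 l (s i) | i : 'I_m].
rewrite -(big_map h P F); apply/perm_big.
have h_inj : injective h.
  move=> s t /eq_in_map e; apply/permP => i; apply/val_inj/eqP.
  rewrite -(nth_uniq x0 _ _ ul) ?sl ?ltn_ord //; apply/eqP/e.
  by rewrite mem_enum.
have h_perm s : h s \in permutations l.
  have uh : uniq (h s).
    rewrite map_inj_uniq ?enum_uniq // => i j /eqP.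
    by rewrite nth_uniq ?sl ?ltn_ord // => /eqP/val_inj/perm_inj.
  have sh : {subset h s <= l}.
    by move=> _ /mapP[i _ ->]; rewrite mem_nth ?sl.
  rewrite mem_permutations; apply: uniq_perm => //.
  by apply: (uniq_min_size uh sh _).2; rewrite size_map size_enum_ord sl.
have uh : uniq (map h (index_enum {perm 'I_m})).
  by rewrite map_inj_uniq ?index_enum_uniq.
apply: uniq_perm; rewrite ?permutations_uniq //.
apply: (uniq_min_size uh _ _).2 => [_ /mapP[s _ ->] //|].
rewrite size_permutations // size_map sl -card_Sn.
by rewrite -cardsT cardsE cardE enumT.
Qed.

(** If the first [size a] letters of a rearrangement of [a ++ b] rearrange [a], then the others
    rearrange [b]; hence cutting after [size a] letters inverts concatenation. *)
Lemma sum_permutations_cat (T : eqType) (a b s : seq T) (F : seq T -> V) :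
  uniq s -> perm_eq (a ++ b) s ->
  (\sum_(v1 <- permutations a) \sum_(v2 <- permutations b) F (v1 ++ v2)
   = \sum_(u <- permutations s | perm_eq (take (size a) u) a) F u)%R.
Proof.
move=> us abs; rewrite -(big_allpairs_dep (h := cat)) -[RHS]big_filter.
apply/perm_big/uniq_perm; rewrite ?filter_uniq ?permutations_uniq //.
  apply: allpairs_uniq; rewrite ?permutations_uniq //.
  move=> p p' /allpairsP[[v k] [pv _ ->]] /allpairsP[[v' k'] [pv' _ ->]].
  move: pv pv' => /=; rewrite !mem_permutations => /perm_size pv /perm_size pv'.
  by move/eqP; rewrite eqseq_cat ?pv // => /andP[/eqP -> /eqP ->].
move=> u; rewrite mem_filter mem_permutations.
apply/allpairsP/andP => [[[v1 v2] /= []]|[pa pu]].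
  rewrite !mem_permutations => p1 p2 ->; rewrite -(perm_size p1) take_size_cat //.
  by rewrite p1 -(permPr abs) perm_cat.
exists (take (size a) u, drop (size a) u); rewrite /= !mem_permutations.
rewrite cat_take_drop pa; split=> //.
rewrite -(perm_cat2l a) (permPr abs) -(permPr pu) -{2}(cat_take_drop (size a) u).
by rewrite perm_cat2r perm_sym.
Qed.

Lemma sum_permutations_cat3 (T : eqType) (a b c s : seq T) (F : seq T -> V) :
  uniq s -> perm_eq (a ++ b ++ c) s ->
  (\sum_(v1 <- permutations a) \sum_(v2 <- permutations b)
      \sum_(v3 <- permutations c) F (v1 ++ v2 ++ v3)
   = \sum_(u <- permutations s | perm_eq (take (size a) u) a
        && perm_eq (take (size b) (drop (size a) u)) b) F u)%R.
Proof.
move=> us abs; have ubc : uniq (b ++ c).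
  by move: us; rewrite -(perm_uniq abs) cat_uniq => /and3P[].
rewrite big_mkcondr -(sum_permutations_cat _ us abs).
apply: eq_big_seq => v1; rewrite mem_permutations => /perm_size sv1.
rewrite (sum_permutations_cat (fun v => F (v1 ++ v)) ubc (perm_refl _)).
by rewrite [LHS]big_mkcond; apply: eq_bigr => v _; rewrite drop_size_cat.
Qed.

(** The increasing blocks of [shuffles1] are the case [p = q = n - 1], those of [shuffles2] the case
    [p = n - 2], [q = n]; the third block is the remainder, of length [n]. *)
Definition shuffled (p q : nat) (w : seq nat) :=
  [&& sorted ltn (take p w), sorted ltn (take q (drop p w))
    & sorted ltn (drop q (drop p w))].

Lemma sorted_ltn_sort (b c : seq nat) :
  sorted ltn b -> perm_eq c b -> b = sort leq c.
Proof.
rewrite ltn_sorted_uniq_leq => /andP[_ sb] cb.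
apply: (sorted_eq leq_trans anti_leq) => //; first exact: sort_sorted leq_total _.
by rewrite perm_sym perm_sort.
Qed.

(* Every word is uniquely a shuffle followed by permutations of its blocks. *)
Lemma sum_shuffled (p q x : nat) (s : seq nat) (F : seq nat -> V) :
  uniq s -> p + q <= size s ->
  (\sum_(w <- permutations s | shuffled p q w && (x \in take q (drop p w)))
      \sum_(v1 <- permutations (take p w))
      \sum_(v2 <- permutations (take q (drop p w)))
      \sum_(v3 <- permutations (drop q (drop p w))) F (v1 ++ v2 ++ v3)
   = \sum_(u <- permutations s | x \in take q (drop p u)) F u)%R.
Proof.
move=> us pqs.
pose same (w u : seq nat) := perm_eq (take p u) (take p w)
  && perm_eq (take q (drop p u)) (take q (drop p w)).
have szE (w : seq nat) : perm_eq w s ->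
    size (take p w) = p /\ size (take q (drop p w)) = q.
  move=> pw; have sw : size w = size s by exact: perm_size.
  rewrite !size_take size_drop sw; split; case: ltnP; lia.
transitivity (\sum_(w <- permutations s | shuffled p q w
    && (x \in take q (drop p w))) \sum_(u <- permutations s | same w u) F u)%R.
  rewrite big_seq_cond [RHS]big_seq_cond; apply: eq_bigr => w.
  rewrite mem_permutations => /andP[pw _].
  rewrite (sum_permutations_cat3 _ us); last by rewrite !cat_take_drop.
  by have [-> ->] := szE w pw.
(* With [u] now fixed, it remains to see that at most one shuffle [w] has blocks with the same
   letters as those of [u], and when there is one. *)
rewrite (exchange_big_dep xpredT) //= [RHS]big_mkcond.
apply: eq_big_seq => u; rewrite mem_permutations => pu.
pose b1 := take p u; pose b2 := take q (drop p u); pose b3 := drop q (drop p u).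
(* The only candidate arises by sorting each block of [u]. *)
pose w0 := sort leq b1 ++ sort leq b2 ++ sort leq b3.
have [s1 s2] := szE u pu.
have E1 : take p w0 = sort leq b1 by rewrite take_size_cat // size_sort.
have E0 : drop p w0 = sort leq b2 ++ sort leq b3.
  by rewrite drop_size_cat // size_sort.
have E2 : take q (drop p w0) = sort leq b2 by rewrite E0 take_size_cat // size_sort.
have E3 : drop q (drop p w0) = sort leq b3 by rewrite E0 drop_size_cat // size_sort.
have uu : uniq u by rewrite (perm_uniq pu).
have pw0 : perm_eq w0 u.
  rewrite -[X in perm_eq _ X](cat_take_drop p u) -(cat_take_drop q (drop p u)).
  by rewrite !perm_cat // perm_sort.
have sh0 : shuffled p q w0.
  have uw0 : uniq w0 by rewrite (perm_uniq pw0).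
  have := uw0; rewrite /shuffled E1 E2 E3 !ltn_sorted_uniq_leq !cat_uniq.
  by case/and3P=> -> _ /and3P[-> _ ->]; rewrite !sort_sorted //; apply: leq_total.
have same0 : same w0 u.
  by rewrite /same E1 E2 !(perm_sym _ (sort _ _)) !perm_sort !perm_refl.
rewrite -big_filter.
have -> : [seq w <- permutations s | shuffled p q w && (x \in take q (drop p w))
             & same w u] = if x \in take q (drop p u) then [:: w0] else [::].
  apply: perm_small_eq; first by case: ifP.
  apply: uniq_perm; rewrite ?filter_uniq ?permutations_uniq //; first by case: ifP.
  move=> w; rewrite mem_filter mem_permutations.
  apply/idP/idP => [/andP[/andP[/andP[shw xw] sm] pw]|].
    have -> : w = w0.
      case/and3P: shw => h1 h2 h3; case/andP: sm => e1 e2.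
      rewrite -(cat_take_drop p w) -(cat_take_drop q (drop p w)).
      rewrite (sorted_ltn_sort h1 e1) (sorted_ltn_sort h2 e2).
      rewrite (sorted_ltn_sort h3 (c := b3)) //.
      (* The third blocks agree up to order: [w] and [u] both rearrange [s], and their first two
         blocks can be cancelled. *)
      rewrite -(perm_cat2l b2) cat_take_drop.
      have -> : perm_eq (drop p u) (b2 ++ drop q (drop p w))
          = perm_eq (drop p u) (drop p w).
        by apply: permPr; rewrite -{2}(cat_take_drop q (drop p w)) perm_cat2r.
      rewrite -(perm_cat2l b1) cat_take_drop (permPl pu) perm_sym -(permPr pw).
      by rewrite -{2}(cat_take_drop p w) perm_cat2r.
    by case/andP: sm => _ /perm_mem ->; rewrite xw inE.
  case: ifP => // xu; rewrite inE => /eqP ->.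
  by rewrite sh0 same0 E2 mem_sort xu (perm_trans pw0).
by case: ifP => _; rewrite ?big_seq1 ?big_nil.
Qed.

(** The block lengths are fixed, so the three blocks can be read off their concatenation; this lets
    the summand treat them separately. *)
Lemma sum_shuffled_blocks (p q x : nat) (s : seq nat)
    (F : seq nat -> seq nat -> seq nat -> V) :
  uniq s -> p + q <= size s ->
  (\sum_(w <- permutations s | shuffled p q w && (x \in take q (drop p w)))
      \sum_(v1 <- permutations (take p w))
      \sum_(v2 <- permutations (take q (drop p w)))
      \sum_(v3 <- permutations (drop q (drop p w))) F v1 v2 v3
   = \sum_(u <- permutations s | x \in take q (drop p u))
       F (take p u) (take q (drop p u)) (drop q (drop p u)))%R.
Proof.
move=> us pqs; pose G u := F (take p u) (take q (drop p u)) (drop q (drop p u)).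
rewrite -(sum_shuffled x G us pqs) big_seq_cond [RHS]big_seq_cond.
have szE (w : seq nat) : size w = size s -> p <= size w /\ q <= size (drop p w).
  by rewrite size_drop; lia.
apply: eq_bigr => w /andP[/size_in_permutations/szE[pw qw] _].
apply: eq_big_seq => v1 /size_in_permutations; rewrite size_takel // => s1.
apply: eq_big_seq => v2 /size_in_permutations; rewrite size_takel // => s2.
by apply: eq_bigr => v3 _;
  rewrite /G take_size_cat ?drop_size_cat // take_size_cat ?drop_size_cat.
Qed.

End PermSums.

Lemma splice_take_drop (T : Type) k m (s : seq T) : k + m <= size s ->
  splice k (take m (drop k s)) (take k s ++ drop (k + m) s) = s.
Proof.
move=> kms; rewrite /splice take_size_cat ?drop_size_cat ?size_takel //; try lia.
by rewrite addnC -drop_drop !cat_take_drop.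
Qed.

(** A new letter will stand for the value of an inner commutator, so that the outer one again
    permutes distinct letters. *)
Lemma exists_fresh (l : seq nat) : exists x, x \notin l.
Proof.
exists (\max_(i <- l) i).+1; apply/negP => /leq_bigmax_seq.
by move=> /(_ predT id isT); rewrite ltnn.
Qed.

Lemma sum_permutations_rcons (V : nmodType) (T : eqType) x (s : seq T)
    (F : seq T -> V) : uniq (x :: s) ->
  (\sum_(v <- permutations (rcons s x)) F v
   = \sum_(v <- permutations s) \sum_(k < (size s).+1) F (insert k x v))%R.
Proof.
move=> us; rewrite -sum_permutations_cons //.
by apply/perm_big/perm_permutations; rewrite perm_rcons.
Qed.

(** * Expanding nested Jordan commutators by multilinearity and total associativity *)

Section Operation.

Variables (n : nat) (K : fieldType) (A : lmodType K) (mu : n.-tuple A -> A).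

(** With 0 as a placeholder at place [k], the word depends on [x] in one entry only, which is the
    form that [multilinear] speaks of. *)
Lemma nth_insert k (x : A) s j : k <= size s ->
  nth 0%R (insert k x s) j = if j == k then x else nth 0%R (insert k 0%R s) j.
Proof.
move=> ks; rewrite !nth_cat size_takel //.
case: ifP => [jk|]; first by rewrite ifF //; lia.
by case: eqP => [->|jk kj]; rewrite ?subnn //= -[j - k]prednK //; lia.
Qed.

Lemma app_insert_sum (mu_lin : multilinear mu) (I : Type) (r : seq I)
    (P : pred I) (F : I -> A) k s : k < n -> k <= size s ->
  app mu (insert k (\sum_(i <- r | P i) F i)%R s)
  = (\sum_(i <- r | P i) app mu (insert k (F i) s))%R.
Proof.
move=> kn ks; pose t := [tuple nth 0%R (insert k 0%R s) j | j < n].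
pose L x := mu [tuple if j == Ordinal kn then x else tnth t j | j < n].
have LE x : app mu (insert k x s) = L x.
  congr mu; apply: eq_from_tnth => j; rewrite !tnth_mktuple nth_insert //.
have LD x y : L (x + y)%R = (L x + L y)%R.
  by have := mu_lin t (Ordinal kn) 1%R x y; rewrite !scale1r.
have L0 : L 0%R = 0%R by apply: (addrI (L 0%R)); rewrite -LD !addr0.
by rewrite LE (big_morph L LD L0); apply: eq_bigr => i _; rewrite LE.
Qed.

(** Exchanging the two insertions brings the sum to the outer one. Its place becomes [k + 1] when
    [j <= k], whence the bound [k < n.-1]. *)
Lemma app_insert2_sum (mu_lin : multilinear mu) (I : Type) (r : seq I)
    (P : pred I) (F : I -> A) j y k s : k < n.-1 -> j < n -> j <= (size s).+1 ->
  k <= size s ->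
  app mu (insert j y (insert k (\sum_(i <- r | P i) F i)%R s))
  = (\sum_(i <- r | P i) app mu (insert j y (insert k (F i) s)))%R.
Proof.
move=> kn jn js ks; have [jk|] := leqP j k.
  rewrite {1}/insert splice_comm_le //= app_insert_sum ?size_splice //=; first last.
  - by rewrite addn1 add1n ltnS.
  - by lia.
  by apply: eq_bigr => i _; rewrite [in RHS]/insert splice_comm_le.
case: j jn js => // j jn js kj; have E x :
    insert j.+1 y (insert k x s) = insert k x (insert j y s).
  by rewrite /insert -[j.+1]addn1 -[1]/(size [:: x]) splice_comm_ge.
rewrite E app_insert_sum ?size_splice //; try lia.
by apply: eq_bigr => i _; rewrite E.
Qed.

(** Distinct labels are permuted rather than their values: [permutations] lists equal words only
    once, so the n! terms would be lost if [g] took a value twice. *)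
Lemma jordan_map (T : eqType) (x0 : T) (g : T -> A) (l : seq T) :
  uniq l -> size l = n ->
  app (jordan mu) (map g l)
  = (\sum_(v <- permutations l) app mu (map g v))%R.
Proof.
move=> ul sl; rewrite -(sum_Sym_permutations x0 predT (fun v => app mu (map g v)) ul sl).
apply: eq_bigr => s _; congr mu; apply: eq_from_tnth => i.
rewrite !tnth_mktuple (nth_map x0) ?sl // -map_comp (nth_map i) ?size_enum_ord //=.
by rewrite nth_ord_enum.
Qed.

Lemma jordan_rcons (g : nat -> A) (l : seq nat) (v : A) :
  uniq l -> (size l).+1 = n ->
  app (jordan mu) (map g l ++ [:: v])
  = (\sum_(w <- permutations l) \sum_(k < n) app mu (insert k v (map g w)))%R.
Proof.
move=> ul sl; have [x xl] := exists_fresh l.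
pose g' y := if y == x then v else g y.
have g'E w : x \notin w -> map g' w = map g w.
  by move=> xw; apply/eq_in_map => y yw; rewrite /g' ifN //; apply: contraNneq xw => <-.
have g'x : g' x = v by rewrite /g' eqxx.
rewrite -(g'E l) // -g'x -[[:: _]]/(map g' [:: x]) -map_cat cats1.
rewrite (jordan_map 0) ?rcons_uniq ?xl ?size_rcons //.
rewrite sum_permutations_rcons /= ?xl // sl; apply: eq_big_seq => w.
rewrite mem_permutations => /perm_mem wl; apply: eq_bigr => k _.
by rewrite map_splice /= g'E // wl.
Qed.

(** First [v1] enters at one of [n - 1] places, treated as the value of a fresh letter, then [v2] at
    one of [n] places. *)
Lemma jordan_rcons2 (g : nat -> A) (l : seq nat) (v1 v2 : A) :
  uniq l -> (size l).+2 = n ->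
  app (jordan mu) (map g l ++ [:: v1; v2])
  = (\sum_(w <- permutations l) \sum_(k < n.-1) \sum_(j < n)
       app mu (insert j v2 (insert k v1 (map g w))))%R.
Proof.
move=> ul sl; have [x xl] := exists_fresh l.
pose g' y := if y == x then v1 else g y.
have g'E w : x \notin w -> map g' w = map g w.
  by move=> xw; apply/eq_in_map => y yw; rewrite /g' ifN //; apply: contraNneq xw => <-.
have g'x : g' x = v1 by rewrite /g' eqxx.
rewrite -cat_rcons -(g'E l) // -g'x -map_rcons.
rewrite jordan_rcons ?rcons_uniq ?xl ?size_rcons //.
have -> : n.-1 = (size l).+1 by rewrite -sl.
rewrite sum_permutations_rcons /= ?xl //; apply: eq_big_seq => w.
rewrite mem_permutations => /perm_mem wl; apply: eq_bigr => k _.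
by apply: eq_bigr => j _; rewrite map_splice /= g'E // wl.
Qed.

Definition collapse k s := take k s ++ app mu (take n (drop k s)) :: drop (k + n) s.

Lemma collapse_splice k b s : size b = n -> k <= size s ->
  collapse k (splice k b s) = insert k (app mu b) s.
Proof.
move=> sb ks; rewrite /collapse addnC -drop_drop.
by rewrite take_size_cat ?drop_size_cat ?size_takel // take_size_cat ?drop_size_cat.
Qed.

Lemma collapse_splice_in k l b s : k <= size s -> l + n <= size b ->
  collapse (k + l) (splice k b s) = splice k (collapse l b) s.
Proof.
move=> ks lb; have db := splice_take_drop lb.
set m := take n _ in db; set r := _ ++ _ in db.
have sm : size m = n by rewrite size_takel // size_drop; lia.
have lr : l <= size r by rewrite size_cat size_takel; lia.
(* With [b] written as [m] spliced into [r], both sides become the value of [m] inserted into a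
   splice of [r] and [s]. *)
rewrite -db collapse_splice // /insert !splice_splice // collapse_splice //.
by rewrite size_splice; lia.
Qed.

Hypothesis mu_assoc : total_associative mu.

(** Total associativity moves the inner bracket by one place; induction moves it to the start. *)
Lemma app_collapse i s : size s = 2 * n - 1 -> i < n ->
  app mu (collapse i s) = app mu (collapse 0 s).
Proof.
move=> ss; elim: i => // i IHi lin; rewrite -IHi ?(ltnW lin) //.
have /eqP st := ss; have := mu_assoc (Tuple st) (i := i).
have blk x y : y = size s -> block x y s = drop x.-1 s.
  by move=> ->; rewrite /block take_oversize // size_drop; lia.
rewrite /= !(blk _ (2 * n - 1)) // /block /= drop0 !subSS !subn0 !addn1 /=.
rewrite !addn2 !subSS addKn => E; rewrite /collapse !addSn /=.
by rewrite E //; lia.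
Qed.

(** For words of length [3 * n - 2] this bracketing serves as the normal form of all double
    bracketings. *)
Definition product s := app mu (collapse 0 (collapse 0 s)).

(** The second bracket moves freely by [app_collapse]. To move the first from [j] to [j + 1], the
    second is placed around both positions and associativity is applied inside it. *)
Lemma app_collapse2 i j s : size s = 3 * n - 2 -> i < n -> j <= 2 * n - 2 ->
  app mu (collapse i (collapse j s)) = product s.
Proof.
move=> ss lin; have szc l : l <= 2 * n - 2 -> size (collapse l s) = 2 * n - 1.
  move=> ll; rewrite size_cat /= size_takel ?size_drop ss; lia.
move=> lj; rewrite app_collapse ?szc //.
elim: j lj => // j IHj lj; rewrite -IHj ?(ltnW lj) // {IHj}.
(* The window of [2 * n - 1] letters from [h] contains the brackets at [j] and at [j + 1], whose
   offsets [l] and [l + 1] are less than [n]; also [h < n], so the second bracket may start at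
   [h]. *)
pose h := minn j n.-1; pose l := j - h.
have hn : h < n by lia.
rewrite -(app_collapse (szc _ lj) hn) -(app_collapse (szc _ (ltnW lj)) hn).
have jE : j = h + l by lia.
have lE : l.+1 < n by lia.
have hs : h + (2 * n - 1) <= size s by rewrite ss; lia.
have ds := splice_take_drop hs; set m := take _ _ in ds; set r := _ ++ _ in ds.
have sm : size m = 2 * n - 1 by rewrite size_takel // size_drop; lia.
have hr : h <= size r by rewrite size_cat size_takel; lia.
have step q : q < n -> app mu (collapse h (collapse (h + q) s))
    = app mu (insert h (app mu (collapse 0 m)) r).
  move=> qn; rewrite -ds collapse_splice_in ?sm //; last lia.
  rewrite collapse_splice ?app_collapse //.
  rewrite size_cat /= size_takel ?size_drop sm; lia.
by rewrite jE -addnS !step //; lia.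
Qed.

(** Hypothesis [e] says that collapsing [c] in the full word leaves [b] spliced into [s]; collapsing
    [b] then gives the left side, so this is an instance of [app_collapse2]. *)
Lemma product_splice i j b s c t : size t = 2 * n - 2 -> j <= size t ->
  size b = n -> size s = n.-1 -> i < n -> size c = n ->
  splice i b s = insert j (app mu c) t ->
  app mu (insert i (app mu b) s) = product (splice j c t).
Proof.
move=> st jt sb ss lin sc e; have ks : i <= size s by rewrite ss; lia.
rewrite -(app_collapse2 (i := i) (j := j)) ?size_splice ?sc ?st //; try lia.
by rewrite collapse_splice // -e collapse_splice.
Qed.

(** Here [k] is the place of the middle bracket in the outer one and [l] that of the innermost
    bracket in the middle one. *)
Lemma jordan_product1 (mu_lin : multilinear mu) (g : nat -> A)
    (b1 b2 b3 : seq nat) :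
  uniq b1 -> uniq b2 -> uniq b3 ->
  (size b1).+1 = n -> (size b2).+1 = n -> size b3 = n ->
  app (jordan mu) (map g b1 ++ [:: app (jordan mu)
    (map g b2 ++ [:: app (jordan mu) (map g b3)])])
  = (\sum_(v1 <- permutations b1) \sum_(v2 <- permutations b2)
     \sum_(v3 <- permutations b3) \sum_(k < n) \sum_(l < n)
       product (map g (splice k (splice l v3 v2) v1)))%R.
Proof.
move=> u1 u2 u3 s1 s2 s3; rewrite jordan_rcons //; apply: eq_big_seq => v1.
move=> /size_in_permutations sv1.
(* The sum over [k] comes first, so that the two inner commutators can be expanded at a fixed outer
   place. *)
transitivity (\sum_(k < n) \sum_(v2 <- permutations b2)
  \sum_(v3 <- permutations b3) \sum_(l < n)
    product (map g (splice k (splice l v3 v2) v1)))%R; last first.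
  rewrite exchange_big; apply: eq_bigr => v2 _.
  by rewrite exchange_big; apply: eq_bigr => v3 _.
apply: eq_bigr => k _.
have kv1 : k <= size (map g v1) by rewrite size_map sv1 -ltnS s1.
rewrite (jordan_map 0) // jordan_rcons // app_insert_sum //.
apply: eq_big_seq => v2 /size_in_permutations sv2.
rewrite app_insert_sum // [RHS]exchange_big; apply: eq_bigr => l _.
have kn := ltn_ord k; have ln := ltn_ord l.
rewrite !app_insert_sum ?size_map ?sv1 ?sv2 //; try lia.
apply: eq_big_seq => v3 /size_in_permutations sv3.
have kv1' : k <= size v1 by rewrite sv1; lia.
rewrite !map_splice splice_splice ?size_map ?sv2 ?sv1; try lia.
apply: product_splice; rewrite ?size_splice ?size_map /= ?sv1 ?sv2 ?sv3 //; try lia.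
by rewrite /insert splice_splice // size_map ?sv2 ?sv1; lia.
Qed.

(** The place [j] counts the value of [v2] as one letter. If [j > k], that letter precedes it, and
    writing out its [n] letters moves the place to [j + n - 1]. *)
Lemma jordan_product2 (mu_lin : multilinear mu) (g : nat -> A)
    (b1 b2 b3 : seq nat) :
  uniq b1 -> uniq b2 -> uniq b3 ->
  (size b1).+2 = n -> size b2 = n -> size b3 = n ->
  app (jordan mu) (map g b1 ++ [:: app (jordan mu) (map g b2);
    app (jordan mu) (map g b3)])
  = (\sum_(v1 <- permutations b1) \sum_(v2 <- permutations b2)
     \sum_(v3 <- permutations b3) \sum_(k < n.-1) \sum_(j < n)
       product (map g (splice (if (j <= k)%N then j : nat else (j + n)%N.-1) v3
         (splice k v2 v1))))%R.
Proof.
move=> u1 u2 u3 s1 s2 s3; rewrite jordan_rcons2 //; apply: eq_big_seq => v1.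
move=> /size_in_permutations sv1.
under [RHS]eq_bigr => v2 _ do rewrite exchange_big.
rewrite [RHS]exchange_big; apply: eq_bigr => k _.
under [RHS]eq_bigr => v2 _ do rewrite exchange_big.
rewrite [RHS]exchange_big; apply: eq_bigr => j _.
rewrite !(jordan_map 0) //.
have kn := ltn_ord k; have jn := ltn_ord j.
have kv1 : k <= size (map g v1) by rewrite size_map sv1; lia.
rewrite app_insert_sum // ?size_splice /= ?size_map ?sv1; last lia.
rewrite [RHS]exchange_big; apply: eq_big_seq => v3 /size_in_permutations sv3.
rewrite app_insert2_sum ?size_map ?sv1 //; try lia.
apply: eq_big_seq => v2 /size_in_permutations sv2.
have kv1' : k <= size v1 by rewrite sv1; lia.
have E c b (s : seq A) : size c = n -> size b = n -> size s = n - 2 ->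
    app mu (insert j (app mu c) (insert k (app mu b) s))
    = product (splice (if j <= k then j : nat else (j + n).-1) c (splice k b s)).
  move=> sc sb ss; case: leqP => jk.
    (* [product_splice] has the block collapsed first, here [b], as the outer splice; hence the
       exchange. *)
    rewrite splice_comm_le ?ss; try lia.
    apply: product_splice; rewrite ?size_splice ?sc ?sb ?ss //=; try lia.
    by rewrite /insert splice_comm_le ?sc //= ss; lia.
  (* Without the value of [b], the place of [c] in [s] is [j - 1]. *)
  have [j' jE] : exists j', j = j'.+1 :> nat by exists j.-1; lia.
  rewrite jE; have -> : j'.+1 + n = (j' + size b).+1 by rewrite sb.
  rewrite /= splice_comm_ge ?ss; try lia.
  apply: product_splice; rewrite ?size_splice ?sc ?sb ?ss //=; try lia.
  by rewrite /insert -[j'.+1]addn1 -[1]/(size [:: app mu b]) splice_comm_ge //= ?ss; lia.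
rewrite !map_splice E ?size_map //; try lia.
Qed.

End Operation.

(** * Reindexing sums over words, and the shuffle conditions in terms of words *)

Lemma sum_rearrange (V : nmodType) (T : eqType) (s : seq T)
    (W : seq T -> seq T) (P Q : pred (seq T)) (F : seq T -> V) :
    uniq s -> {in permutations s, forall u, perm_eq (W u) s} ->
    {in permutations s &, injective W} ->
    {in permutations s, forall u, P u = Q (W u)} ->
  (\sum_(u <- permutations s | P u) F (W u)
   = \sum_(u <- permutations s | Q u) F u)%R.
Proof.
move=> us pW injW PQ.
have uW : uniq (map W (permutations s)).
  by rewrite map_inj_in_uniq ?permutations_uniq.
rewrite big_seq_cond (eq_bigl (fun u => (u \in permutations s) && Q (W u))).
  rewrite -big_seq_cond -(big_map W Q F); apply/perm_big/uniq_perm => //.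
    exact: permutations_uniq.
  (* An injection of the finite set of permutations of [s] into itself is onto. *)
  apply: (uniq_min_size uW _ _).2; rewrite ?size_map //.
  by move=> _ /mapP[u pu ->]; rewrite mem_permutations pW.
by move=> u; case: (boolP (u \in _)) => //= /PQ.
Qed.

Lemma one_lineE (m : nat) (s : 'S_m) :
  one_line s = [seq nth 0 (iota 1 m) (s i) | i : 'I_m].
Proof. by apply: eq_map => i; rewrite nth_iota // add1n. Qed.

Lemma permutedE (V : zmodType) (m : nat) (t : m.-tuple V) (s : 'S_m) :
  permuted t s = [seq nth 0%R t i.-1 | i <- one_line s].
Proof. by rewrite -map_comp; apply: eq_map => i; rewrite (tnth_nth 0%R). Qed.

(** All letters are at least 1, so an increasing block that contains 1 starts with it. *)
Lemma sorted_nth_eq1 (w : seq nat) p q : 0 < q -> 0 \notin w ->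
  p < size w -> sorted ltn (take q (drop p w)) ->
  (nth 0 w p == 1) = (1 \in take q (drop p w)).
Proof.
move=> q0 w0 pw sw; have dw := drop_nth 0 pw; have pq := prednK q0.
have x0 : nth 0 w p != 0 by apply: contraNneq w0 => <-; rewrite mem_nth.
move: sw; rewrite dw -pq /= inE eq_sym; case: eqP => //= ne.
rewrite (path_sortedE ltn_trans) => /andP[/allP h _].
by apply/esym/negP => /h /=; lia.
Qed.

Section Blocks.

Variables (n p q : nat).
Hypotheses (hn : 2 <= n) (pq : p + q = 2 * n - 2) (q0 : 0 < q).

Lemma block_first (T : Type) (w : seq T) : block 1 p w = take p w.
Proof. by rewrite /block drop0 subn1. Qed.

Lemma block_second (T : Type) (w : seq T) :
  block p.+1 (2 * n - 2) w = take q (drop p w).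
Proof. by rewrite /block -pq subSS addKn. Qed.

Lemma block_second_behead (T : Type) (w : seq T) :
  block p.+2 (2 * n - 2) w = behead (take q (drop p w)).
Proof.
rewrite /block -pq subSS /=; have -> : p + q - p.+1 = q.-1 by lia.
rewrite -add1n -drop_drop drop1.
by case: (drop p w) => [|y l] //=; rewrite -[in RHS](prednK q0).
Qed.

Lemma block_third (T : Type) (w : seq T) : size w = 3 * n - 2 ->
  block (2 * n - 1) (3 * n - 2) w = drop q (drop p w).
Proof.
move=> sw; rewrite drop_drop addnC pq /block take_oversize ?size_drop ?sw; last lia.
by congr drop; lia.
Qed.

Lemma shuffled_blocks (w : seq nat) : perm_eq w (iota 1 (3 * n - 2)) ->
  [&& sorted ltn (block 1 p w), sorted ltn (block p.+1 (2 * n - 2) w),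
      sorted ltn (block (2 * n - 1) (3 * n - 2) w) & nth 0 w p == 1]
  = shuffled p q w && (1 \in take q (drop p w)).
Proof.
move=> pw; have sw : size w = 3 * n - 2.
  by rewrite -(size_iota 1 (3 * n - 2)); apply: perm_size.
rewrite block_first block_second block_third // /shuffled -!andbA.
case: (sorted ltn (take p w)) => //=; case: (boolP (sorted _ _)) => //= s2.
by rewrite (sorted_nth_eq1 q0) // ?(perm_mem pw) ?mem_iota //; lia.
Qed.

End Blocks.

(** * The position of $t_1$ and the count of insertion places *)

Lemma mem_uniq_cat3 (T : eqType) x (b1 b2 b3 : seq T) :
  uniq (b1 ++ b2 ++ b3) -> x \in b1 ++ b2 ++ b3 ->
  [|| [&& x \in b1, x \notin b2 & x \notin b3],
      [&& x \in b2, x \notin b1 & x \notin b3]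
    | [&& x \in b3, x \notin b1 & x \notin b2]].
Proof.
rewrite !cat_uniq !mem_cat => /and3P[_ /hasPn/(_ x) h /and3P[_ /hasPn/(_ x) h' _]].
move: h h'; rewrite mem_cat.
by case: (x \in b1); case: (x \in b2); case: (x \in b3) => //= h h';
  solve [by [] | by have := h isT | by have := h' isT].
Qed.

(* in_nested n k l x (resp. in_separate n k j x) says that a word with t_1 at
   index x (counted from 0) fits a term of F1 (resp. F2), where k is the place at
   which the operation on t_1 is inserted in the outer one; the remaining value is
   inserted at l in the former, resp. afterwards at j in the outer one. *)
Definition in_nested n k l x := (k <= x < k + l) || (k + l + n <= x < k + 2 * n - 1).

Definition in_separate n k j x := if j <= k then k + n <= x < k + 2 * n
  else k <= x < k + n.

Lemma sum_in_nested_separate (V : nmodType) (n l x : nat) (M : V) : l < n ->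
  (\sum_(k < n | in_nested n k l x) M = \sum_(k < n.-1 | in_separate n k l x) M)%R.
Proof.
move=> ln; rewrite (big_ord_widen_cond n (fun k => in_separate n k l x)
  (fun=> M)) ?leq_pred //.
(* Each reflection preserves its own range of [k]; the other [k] are fixed and satisfy neither
   [in_nested] nor [in_separate]. *)
pose f k := if k <= x < k + n then x - k
  else if k + n <= x < k + 2 * n then x - n - k else k.
have fn k : k < n -> f k < n by rewrite /f; do 2?[case: ifP => ?]; lia.
have fK k : k < n -> f (f k) = k.
  move=> kn; rewrite /f; case: (boolP (k <= x < k + n)) => c1.
    by rewrite ifT; lia.
  case: (boolP (k + n <= x < k + 2 * n)) => c2; last by rewrite ifN // ifN.
  by rewrite ifN; [rewrite ifT; lia | lia].
pose phi (k : 'I_n) := Ordinal (fn k (ltn_ord k)).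
have phiK : involutive phi by move=> k; apply: val_inj; apply: fK.
rewrite (reindex_inj (inv_inj phiK)); apply: eq_bigl => k /=.
(* In the first range [in_nested] at [x - k] means [k < l]; in the second, at [x - n - k], it means
   [l <= k < n - 1]. These are the [k] below [n - 1] that [in_separate] selects. *)
have := ltn_ord k; rewrite /in_nested /in_separate /f; move: (nat_of_ord k) => i lin.
case: (boolP (i <= x < i + n)) => c1; first by case: (leqP l i) => li; lia.
by case: (boolP (i + n <= x < i + 2 * n)) => c2; case: (leqP l i) => li; lia.
Qed.

Section IndexWords.

Variables (n : nat) (x : nat) (b1 b2 b3 : seq nat).
Hypotheses (ub : uniq (b1 ++ b2 ++ b3)) (xb : x \in b1 ++ b2 ++ b3).

(** The letters of [b2] before place [l] are shifted by [k], the others by [k + n]; this gives the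
    two intervals of [in_nested]. *)
Lemma in_nested_index k l : k < n -> l < n ->
  size b1 = n.-1 -> size b2 = n.-1 -> size b3 = n ->
  (x \in b2) = in_nested n k l (index x (splice k (splice l b3 b2) b1)).
Proof.
move=> kn ln s1 s2 s3; have dj := mem_uniq_cat3 ub xb.
have [u1 u2] : uniq b1 /\ uniq b2.
  by move: ub; rewrite !cat_uniq => /and5P[].
have cM : (x \in splice l b3 b2) = (x \in b3) || (x \in b2).
  by rewrite (perm_mem (perm_splice _ _ _)) mem_cat.
have k1 : k <= size b1 by rewrite s1; lia.
have l2 : l <= size b2 by rewrite s2; lia.
rewrite /in_nested index_splice ?cM ?size_splice ?s2 ?s3 //; first last.
- by case/or3P: dj => /and3P[-> /negbTE-> /negbTE->].
- by case/or3P: dj => /and3P[-> /negbTE-> /negbTE->].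
case/or3P: dj => /and3P[x1 /negbTE n2 /negbTE n3]; rewrite ?x1 ?n2 ?n3 /=.
- by move: x1; rewrite -index_mem s1; move: (index x b1) => y; case: ifP; lia.
- rewrite index_splice ?x1 ?n2 ?n3 //.
  by move: x1; rewrite -index_mem s2 s3; move: (index x b2) => y; case: ifP; lia.
rewrite index_splice ?x1 ?n2 ?n3 //.
by move: x1; rewrite -index_mem s3; move: (index x b3) => y; lia.
Qed.

(** The letters of [b2] fill [n] consecutive places from [k] on, moved by another [n] exactly when
    [b3] enters at [j <= k]. *)
Lemma in_separate_index k j : k < n.-1 -> j < n ->
  size b1 = n - 2 -> size b2 = n -> size b3 = n ->
  (x \in b2) = in_separate n k j
    (index x (splice (if j <= k then j else (j + n).-1) b3 (splice k b2 b1))).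
Proof.
move=> kn jn s1 s2 s3; have dj := mem_uniq_cat3 ub xb.
have u1 : uniq b1 by move: ub; rewrite cat_uniq => /and3P[].
have cM : (x \in splice k b2 b1) = (x \in b2) || (x \in b1).
  by rewrite (perm_mem (perm_splice _ _ _)) mem_cat.
have uc : uniq (splice k b2 b1).
  rewrite (perm_uniq (perm_splice _ _ _)) uniq_catC.
  by apply: subseq_uniq ub; rewrite catA prefix_subseq.
have k1 : k <= size b1 by rewrite s1; lia.
have ib : (if j <= k then j else (j + n).-1) <= n + size b1.
  by rewrite s1; case: ifP; lia.
rewrite /in_separate index_splice ?cM ?size_splice ?s2 ?s3 //; first last.
- by case/or3P: dj => /and3P[-> /negbTE-> /negbTE->].
- by case/or3P: dj => /and3P[-> /negbTE-> /negbTE->].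
case/or3P: dj => /and3P[x1 /negbTE n2 /negbTE n3];
  rewrite ?x1 ?n2 ?n3 /=.
- rewrite index_splice ?x1 ?n2 ?n3 //; move: x1; rewrite -index_mem s1 s2.
  move: (index x b1) => y; clear -kn jn.
  by case: (leqP j k) => jk; case: (ltnP y k) => yk; case: ifP => ?; lia.
- rewrite index_splice ?x1 ?n2 ?n3 //; move: x1; rewrite -index_mem s2.
  move: (index x b2) => y; clear -kn jn.
  by case: (leqP j k) => jk; case: ifP => ?; lia.
move: x1; rewrite -index_mem s3; move: (index x b3) => y; clear -kn jn.
by case: (leqP j k) => jk; lia.
Qed.

End IndexWords.

(** * The two sums as sums over words, and their comparison *)

Section Main.

Variables (n : nat) (hn : 2 <= n) (K : fieldType) (A : lmodType K).
Variables (mu : n.-tuple A -> A) (mu_lin : multilinear mu).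
Variables (mu_assoc : total_associative mu) (a : (3 * n - 2).-tuple A).

Notation N := (3 * n - 2).
Let g (i : nat) : A := nth 0%R a i.-1.
Let m (u : seq nat) : A := product mu (map g u).

(** This produces the explicit $t_1$ in [F1] and [F2]: the increasing second block starts with the
    letter 1. *)
Lemma map_second_block p q (w : seq nat) : 0 < q -> 1 \in take q (drop p w) ->
  shuffled p q w -> perm_eq w (iota 1 N) -> p < size w ->
  map g (take q (drop p w)) = nth 0%R a 0 :: behead (take q (drop p (map g w))).
Proof.
move=> q0 + /and3P[_ s2 _] pw pltw; rewrite -sorted_nth_eq1 //; last first.
  by rewrite (perm_mem pw) mem_iota.
by move=> /eqP w1; rewrite -map_drop -map_take (drop_nth 0) // -(prednK q0) /= w1.
Qed.

Lemma block_sizes p q (w : seq nat) : p + q = 2 * n - 2 -> perm_eq w (iota 1 N) ->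
  [/\ size w = N, size (take p w) = p, size (take q (drop p w)) = q,
      size (drop q (drop p w)) = n &
  [/\ uniq (take p w), uniq (take q (drop p w)) & uniq (drop q (drop p w))]].
Proof.
move=> pq pw; have sw : size w = N.
  by rewrite -(size_iota 1 N); apply: perm_size.
have uw : uniq w by rewrite (perm_uniq pw) iota_uniq.
rewrite !size_drop !size_take !size_drop sw.
split; [by [] | by case: ltnP; lia | by case: ltnP; lia | lia |].
by rewrite !take_uniq ?drop_uniq.
Qed.

Lemma F1_shuffled : F1 (jordan mu) a =
  (\sum_(w <- permutations (iota 1 N)
      | shuffled n.-1 n.-1 w && (1%N \in take n.-1 (drop n.-1 w)))
    \sum_(v1 <- permutations (take n.-1 w))
    \sum_(v2 <- permutations (take n.-1 (drop n.-1 w)))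
    \sum_(v3 <- permutations (drop n.-1 (drop n.-1 w)))
    \sum_(k < n) \sum_(l < n) m (splice k (splice l v3 v2) v1))%R.
Proof.
pose P w := [&& sorted ltn (block 1 (n - 1) w), sorted ltn (block n (2 * n - 2) w),
  sorted ltn (block (2 * n - 1) N w) & nth 0 w n.-1 == 1].
pose T w := app (jordan mu) (block 1 (n - 1) (map g w) ++
  [:: app (jordan mu) (nth 0%R a 0 :: block (n + 1) (2 * n - 2) (map g w) ++
  [:: app (jordan mu) (block (2 * n - 1) N (map g w))])]).
(* A permutation is replaced by its one-line word, so that conditions and summand depend on the word
   alone. *)
transitivity (\sum_(w <- permutations (iota 1 N) | P w) T w)%R.
  rewrite -(sum_Sym_permutations 0 P T (iota_uniq _ _) (size_iota _ _)).
  apply: eq_big => s; first by rewrite inE -one_lineE /P /perm_at -!andbA.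
  by rewrite -one_lineE /T permutedE.
have pq : n.-1 + n.-1 = 2 * n - 2 by lia.
have q0 : 0 < n.-1 by lia.
have PE (w : seq nat) : perm_eq w (iota 1 N) ->
    P w = shuffled n.-1 n.-1 w && (1 \in take n.-1 (drop n.-1 w)).
  by move=> pw; rewrite -(shuffled_blocks hn pq q0 pw) /P subn1 prednK //; lia.
rewrite big_seq_cond [RHS]big_seq_cond; apply: eq_big => [w|w].
  by case: (boolP (w \in _)) => //=; rewrite mem_permutations => /PE.
rewrite mem_permutations => /andP[pw]; rewrite PE // => /andP[sh w1].
have [sw s1 s2 s3 [u1 u2 u3]] := block_sizes pq pw.
rewrite -jordan_product1 ?s1 ?s2 ?s3 //; try lia.
rewrite (map_second_block q0 w1 sh pw) ?sw; last lia.
have nE : n + 1 = n.-1.+2 by lia.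
rewrite /T nE subn1 block_first (block_second_behead hn pq q0).
by rewrite (block_third hn pq) ?size_map // -!map_drop -!map_take.
Qed.

Lemma F2_shuffled : F2 (jordan mu) a =
  (\sum_(w <- permutations (iota 1 N)
      | shuffled (n - 2) n w && (1%N \in take n (drop (n - 2) w)))
    \sum_(v1 <- permutations (take (n - 2) w))
    \sum_(v2 <- permutations (take n (drop (n - 2) w)))
    \sum_(v3 <- permutations (drop n (drop (n - 2) w)))
    \sum_(k < n.-1) \sum_(j < n)
      m (splice (if (j <= k)%N then j : nat else (j + n)%N.-1) v3 (splice k v2 v1)))%R.
Proof.
pose P w := [&& sorted ltn (block 1 (n - 2) w), sorted ltn (block (n - 1) (2 * n - 2) w),
  sorted ltn (block (2 * n - 1) N w), nth 0 w (n - 1).-1 < nth 0 w (2 * n - 1).-1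
  & nth 0 w (n - 1).-1 == 1].
pose T w := app (jordan mu) (block 1 (n - 2) (map g w) ++
  [:: app (jordan mu) (nth 0%R a 0 :: block n (2 * n - 2) (map g w));
      app (jordan mu) (block (2 * n - 1) N (map g w))]).
transitivity (\sum_(w <- permutations (iota 1 N) | P w) T w)%R.
  rewrite -(sum_Sym_permutations 0 P T (iota_uniq _ _) (size_iota _ _)).
  apply: eq_big => s; first by rewrite inE -one_lineE /P /perm_at -!andbA.
  by rewrite -one_lineE /T permutedE.
have pq : (n - 2) + n = 2 * n - 2 by lia.
have q0 : 0 < n by lia.
have p1 : n - 1 = (n - 2).+1 by lia.
have PE (w : seq nat) : perm_eq w (iota 1 N) ->
    P w = shuffled (n - 2) n w && (1 \in take n (drop (n - 2) w)).
  move=> pw; rewrite -(shuffled_blocks hn pq q0 pw) /P p1 /=.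
  (* If the second block starts with 1, the third starts with a larger letter, since the letters are
     distinct and positive. *)
  do 3![congr (_ && _)]; rewrite andbC; case: eqP => //= w1.
  have sw : size w = N by rewrite -(size_iota 1 N); apply: perm_size.
  have uw : uniq w by rewrite (perm_uniq pw) iota_uniq.
  have ix : (2 * n - 1).-1 < size w by rewrite sw; lia.
  have ip : n - 2 < size w by rewrite sw; lia.
  have := mem_nth 0 ix; rewrite (perm_mem pw) mem_iota => /andP[x1 _].
  have : nth 0 w (2 * n - 1).-1 != nth 0 w (n - 2) by rewrite nth_uniq //; lia.
  by rewrite w1 => ne; rewrite ltn_neqAle eq_sym ne.
rewrite big_seq_cond [RHS]big_seq_cond; apply: eq_big => [w|w].
  by case: (boolP (w \in _)) => //=; rewrite mem_permutations => /PE.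
rewrite mem_permutations => /andP[pw]; rewrite PE // => /andP[sh w1].
have [sw s1 s2 s3 [u1 u2 u3]] := block_sizes pq pw.
rewrite -jordan_product2 ?s1 ?s2 ?s3 //; try lia.
rewrite (map_second_block q0 w1 sh pw) ?sw; last lia.
have nE : n = (n - 2).+2 by lia.
have bE : block n (2 * n - 2) (map g w) = behead (take n (drop (n - 2) (map g w))).
  by rewrite -(block_second_behead hn pq q0) -nE.
rewrite /T bE block_first.
by rewrite (block_third hn pq) ?size_map // -!map_drop -!map_take.
Qed.

Lemma F1_words : F1 (jordan mu) a =
  (\sum_(k < n) \sum_(l < n)
    \sum_(u <- permutations (iota 1 N) | in_nested n k l (index 1%N u)) m u)%R.
Proof.
have pq : n.-1 + n.-1 = 2 * n - 2 by lia.
have uN : uniq (iota 1 N) := iota_uniq _ _.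
rewrite F1_shuffled sum_shuffled_blocks ?size_iota //; last lia.
rewrite exchange_big; apply: eq_bigr => k _.
rewrite exchange_big; apply: eq_bigr => l _.
have kn := ltn_ord k; have ln := ltn_ord l.
(* For fixed [k] and [l], reassembling the three blocks of [u] in this way permutes the set of
   words. *)
pose W (u : seq nat) := splice k
  (splice l (drop n.-1 (drop n.-1 u)) (take n.-1 (drop n.-1 u))) (take n.-1 u).
have cE (u : seq nat) :
    u = take n.-1 u ++ take n.-1 (drop n.-1 u) ++ drop n.-1 (drop n.-1 u).
  by rewrite !cat_take_drop.
apply: (@sum_rearrange _ _ _ W (fun u => 1 \in take n.-1 (drop n.-1 u))
  (fun u => in_nested n k l (index 1 u)) m uN).
- move=> u; rewrite mem_permutations => pu; rewrite -(permPr pu).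
  apply: perm_trans (perm_splice _ _ _) _; rewrite perm_catC.
  rewrite [X in perm_eq _ X]cE perm_cat2l.
  by apply: perm_trans (perm_splice _ _ _) _; rewrite perm_catC.
- move=> u v; rewrite !mem_permutations => /(block_sizes pq) [_ s1 s2 s3 _].
  move=> /(block_sizes pq) [_ t1 t2 t3 _] /splice_inj.
  rewrite !size_splice s1 s2 s3 t1 t2 t3 => -[] // /splice_inj.
  by rewrite s2 s3 t2 t3 => -[] // e3 e2 e1; rewrite [u]cE [v]cE e1 e2 e3.
move=> u; rewrite mem_permutations => pu.
have [su s1 s2 s3 [u1 u2 u3]] := block_sizes pq pu.
have uu : uniq u by rewrite (perm_uniq pu).
have xu : 1 \in u by rewrite (perm_mem pu) mem_iota; lia.
by rewrite (cE u) in uu xu; exact: in_nested_index.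
Qed.

Lemma F2_words : F2 (jordan mu) a =
  (\sum_(k < n.-1) \sum_(j < n)
    \sum_(u <- permutations (iota 1 N) | in_separate n k j (index 1%N u)) m u)%R.
Proof.
have pq : n - 2 + n = 2 * n - 2 by lia.
have uN : uniq (iota 1 N) := iota_uniq _ _.
rewrite F2_shuffled sum_shuffled_blocks ?size_iota //; last lia.
rewrite exchange_big; apply: eq_bigr => k _.
rewrite exchange_big; apply: eq_bigr => j _.
have kn := ltn_ord k; have jn := ltn_ord j.
set i := if _ then _ else _.
pose W (u : seq nat) := splice i (drop n (drop (n - 2) u))
  (splice k (take n (drop (n - 2) u)) (take (n - 2) u)).
have cE (u : seq nat) :
    u = take (n - 2) u ++ take n (drop (n - 2) u) ++ drop n (drop (n - 2) u).
  by rewrite !cat_take_drop.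
apply: (@sum_rearrange _ _ _ W (fun u => 1 \in take n (drop (n - 2) u))
  (fun u => in_separate n k j (index 1 u)) m uN).
- move=> u; rewrite mem_permutations => pu; rewrite -(permPr pu).
  apply: perm_trans (perm_splice _ _ _) _; rewrite perm_catC.
  rewrite [X in perm_eq _ X]cE catA perm_cat2r.
  by apply: perm_trans (perm_splice _ _ _) _; rewrite perm_catC.
- move=> u v; rewrite !mem_permutations => /(block_sizes pq) [_ s1 s2 s3 _].
  move=> /(block_sizes pq) [_ t1 t2 t3 _] /splice_inj.
  rewrite !size_splice s1 s2 s3 t1 t2 t3 => -[] // e3 /splice_inj.
  by rewrite s1 s2 t1 t2 => -[] // e2 e1; rewrite [u]cE [v]cE e1 e2 e3.
move=> u; rewrite mem_permutations => pu.
have [su s1 s2 s3 [u1 u2 u3]] := block_sizes pq pu.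
have uu : uniq u by rewrite (perm_uniq pu).
have xu : 1 \in u by rewrite (perm_mem pu) mem_iota; lia.
by rewrite (cE u) in uu xu; exact: in_separate_index.
Qed.

End Main.

Local Open Scope ring_scope.

Theorem theorem1p3 (n : nat) (hn : (2 <= n)%N) (K : fieldType) (A : lmodType K)
    (mu : n.-tuple A -> A) (mu_lin : multilinear mu)
    (mu_assoc : total_associative mu) (a : (3 * n - 2).-tuple A) :
  f2 (-1) (jordan mu) a = 0.
Proof.
rewrite /f2 scaleN1r; apply/eqP; rewrite subr_eq0; apply/eqP.
(* The place [l] of the remaining value has the same range in both sums and is fixed from here
   on. *)
rewrite F1_words // F2_words // exchange_big [RHS]exchange_big.
apply: eq_bigr => l _.
(* As indicators in the summand, the conditions let the word [u] be fixed as well; only the count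
   over [k] is left. *)
under eq_bigr => k _ do rewrite big_mkcond.
rewrite exchange_big.
under [RHS]eq_bigr => k _ do rewrite big_mkcond.
rewrite [RHS]exchange_big; apply: eq_bigr => u _.
by rewrite -!big_mkcond sum_in_nested_separate.
Qed.
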